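(* There exist vector configurations in arbitrary dimension which are supernormal but not unimodular.
   Context: A vector configuration is a finite set $\mathcal{A}$ of vectors in $\mathbb{Z}^n$; its dimension is $n$. A Hilbert basis of a rational polyhedral cone $K\subseteq\mathbb{R}^n$ is a finite set $H \subset K \cap \mathbb{Z}^n$ such that every element of $K \cap \mathbb{Z}^n$ is a nonnegative integer combination of elements of $H$. A configuration $\mathcal{A} \subset \mathbb{Z}^n$ is unimodular if every subset $\mathcal{A}' \subseteq \mathcal{A}$ is a Hilbert basis of $\mathrm{cone}(\mathcal{A}')$. It is supernormal if for every subset $\mathcal{A}' \subseteq \mathcal{A}$, the set $\mathcal{A} \cap \mathrm{cone}(\mathcal{A}')$ is a Hilbert basis of $\mathrm{cone}(\mathcal{A}')$. *)

(* Defs.v *)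
From mathcomp Require Import all_boot all_order all_algebra finmap.
From mathcomp Require Import boolp classical_sets reals.
Set Implicit Arguments.
Unset Strict Implicit.
Unset Printing Implicit Defensive.
Import Order.TTheory GRing.Theory Num.Theory.
Local Open Scope ring_scope.
Local Open Scope fset_scope.
Local Open Scope classical_set_scope.

(* A vector configuration of dimension n is a term of type
   {fset 'rV[int]_n}: the dimension is that of the ambient lattice. *)

Definition realvec (R : realType) (n : nat) (v : 'rV[int]_n) : 'rV[R]_n :=
  map_mx (fun z : int => z%:~R) v.

Definition cone (R : realType) (n : nat) (A : {fset 'rV[int]_n}) :
    set 'rV[R]_n :=
  [set x | exists c : 'rV[int]_n -> R,
     (forall v, v \in A -> 0 <= c v) /\
     x = \sum_(v <- A) c v *: realvec R v].

Arguments cone R {n} A _.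

(* Only ever applied to K = cone R A, which is a rational polyhedral cone since
   A is a finite set of integer vectors. No minimality of H is required. *)
Definition hilbert_basis (R : realType) (n : nat) (K : set 'rV[R]_n)
    (H : {fset 'rV[int]_n}) : Prop :=
  (forall h, h \in H -> K (realvec R h)) /\
  (forall z : 'rV[int]_n, K (realvec R z) ->
     exists c : 'rV[int]_n -> nat, z = \sum_(h <- H) h *+ c h).

Definition unimodular (R : realType) (n : nat) (A : {fset 'rV[int]_n}) : Prop :=
  forall A' : {fset 'rV[int]_n}, (A' `<=` A)%fset ->
    hilbert_basis (cone R A') A'.

Definition supernormal (R : realType) (n : nat) (A : {fset 'rV[int]_n}) : Prop :=
  forall A' : {fset 'rV[int]_n}, (A' `<=` A)%fset ->
    hilbert_basis (cone R A')
      [fset v in A | `[< cone R A' (realvec R v) >]]%fset.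

Arguments unimodular R {n} A.
Arguments supernormal R {n} A.

(* Main.v *)
Require Import Defs.
From mathcomp Require Import all_boot all_order all_algebra finmap.
From mathcomp Require Import boolp classical_sets reals.

(** The witness is [e_1, ..., e_n] together with [2 e_1].  All its vectors lie
    on the coordinate half-axes, so a subconfiguration [A'] spans a face of the
    nonnegative orthant: the one spanned by the axes that [A'] meets.  The
    lattice points of such a face are the nonnegative integer combinations of
    the unit vectors of these axes, and those unit vectors belong to the
    configuration even when they do not belong to [A']; hence supernormality
    ([axis_supernormal]).  Unimodularity asks [A'] itself to generate the
    lattice points of its cone, and fails for [A' = {2 e_1}], which misses
    [e_1] ([not_unimodular_double]). *)

Import Order.TTheory GRing.Theory Num.Theory.
Local Open Scope ring_scope.

Lemma realvecMn (R : realType) (n : nat) (v : 'rV[int]_n) (k : nat) :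
  realvec R (v *+ k) = realvec R v *+ k.
Proof. by apply/rowP => j; rewrite !(mxE, mulmxnE) rmorphMn. Qed.

Lemma cone_divMn (R : realType) (n : nat) (A : {fset 'rV[int]_n})
    (v : 'rV[int]_n) (k : nat) :
  (0 < k)%N -> v *+ k \in A -> cone R A (realvec R v).
Proof.
move=> k_gt0 vkA.
exists (fun w => if w == v *+ k then k%:R^-1 else 0); split.
  by move=> w _; case: ifP; rewrite // invr_ge0 ler0n.
rewrite (big_fsetD1 _ vkA) /= eqxx big_seq big1 => [|w].
  rewrite addr0 realvecMn -scaler_nat scalerA mulVf ?scale1r //.
  by rewrite pnatr_eq0 -lt0n.
by rewrite !inE => /andP[/negPf-> _]; rewrite scale0r.
Qed.

Lemma cone_coord_ge0 (R : realType) (n : nat) (A : {fset 'rV[int]_n})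
    (z : 'rV[int]_n) (i : 'I_n) :
  (forall v, v \in A -> 0 <= v 0 i) -> cone R A (realvec R z) -> 0 <= z 0 i.
Proof.
move=> A_ge0 [c [c_ge0 /rowP/(_ i)]]; rewrite mxE summxE => zi.
rewrite -(ler0z R) zi big_seq sumr_ge0 // => v vA.
by rewrite !mxE mulr_ge0 ?c_ge0 // ler0z A_ge0.
Qed.

Lemma cone_coord_neq0 (R : realType) (n : nat) (A : {fset 'rV[int]_n})
    (z : 'rV[int]_n) (i : 'I_n) :
  cone R A (realvec R z) -> z 0 i != 0 -> exists2 v, v \in A & v 0 i != 0.
Proof.
move=> [c [_ /rowP/(_ i)]]; rewrite mxE summxE => zi zi_neq0.
apply: contrapT => noA; move/eqP: zi_neq0; apply.
apply/eqP; rewrite -(intr_eq0 R) zi big_seq big1 // => v vA.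
rewrite !mxE; have [->|vi] := eqVneq (v 0 i) 0; first by rewrite mulr0.
by case: noA; exists v.
Qed.

(** [z] is the sum of its coordinates times the unit vectors, and a unit vector
    outside [H] contributes nothing because its coordinate vanishes. *)
Lemma unit_vectors_generate (n : nat) (H : {fset 'rV[int]_n})
    (z : 'rV[int]_n) :
  (forall i, 0 <= z 0 i) -> (forall i, z 0 i != 0 -> delta_mx 0 i \in H) ->
  exists c : 'rV[int]_n -> nat, z = \sum_(h <- H) h *+ c h.
Proof.
move=> z_ge0 zH.
(* The sum has at most one term: it is the i-th coordinate of [z] when [h] is
   the i-th unit vector, and 0 when [h] is not a unit vector. *)
exists (fun h => (\sum_(i | h == delta_mx 0%R i) `|z 0%R i|)%N).
transitivity (\sum_(h <- H) \sum_(i | h == delta_mx 0 i)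
                (delta_mx 0 i : 'rV[int]_n) *+ `|z 0%R i|%N); last first.
  by apply: eq_bigr => h _; rewrite -sumrMnr; apply: eq_bigr => i /eqP->.
rewrite (exchange_big_dep predT) //= [LHS]row_sum_delta.
apply: eq_bigr => i _.
have [-> | /[dup] zi /zH eH] := eqVneq (z 0 i) 0.
  by rewrite scale0r big1.
rewrite big_mkcond (big_fsetD1 _ eH) /= eqxx big_seq big1 => [|h].
  by rewrite addr0 -scaler_nat natz gez0_abs.
by rewrite !inE => /andP[/negPf->].
Qed.

(** If [A'] meets the axis of [e_i], the cone of [A'] contains [e_i]; so
    [e_i] survives in the intersection of [A] with that cone. *)
Lemma axis_supernormal (R : realType) (n : nat) (A : {fset 'rV[int]_n}) :
  (forall i, delta_mx 0 i \in A) ->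
  (forall v, v \in A -> exists i k, v = delta_mx 0 i *+ k) ->
  supernormal R A.
Proof.
move=> eA axisA A' /fsubsetP sA'A; split.
  by move=> h; rewrite !inE => /andP[_ /asboolP].
move=> z zK; apply: unit_vectors_generate => i.
  apply: cone_coord_ge0 zK => v /sA'A/axisA[j [k ->]].
  by rewrite mulmxnE mxE mulrn_wge0 // ler0n.
move=> zi; have [v vA' vi] := cone_coord_neq0 _ _ _ _ _ zK zi.
rewrite !inE eA /=; apply/asboolP.
have [j [k vE]] := axisA v (sA'A v vA'); subst v.
move: vi; rewrite mulmxnE mxE eqxx /=.
have [-> | _] := eqVneq i j; last by rewrite mul0rn eqxx.
by case: k vA' => [|k] vA' // _; exact: cone_divMn vA'.
Qed.

Lemma not_unimodular_double (R : realType) (n : nat) (A : {fset 'rV[int]_n})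
    (i : 'I_n) :
  delta_mx 0 i *+ 2 \in A -> ~ unimodular R A.
Proof.
move=> A2 /(_ [fset delta_mx 0 i *+ 2]%fset).
rewrite fsub1set => /(_ A2)[_ /(_ (delta_mx 0 i))[]].
  by apply: (cone_divMn _ _ _ _ 2); rewrite ?inE.
move=> c; rewrite big_seq_fset1 => /rowP/(_ i).
rewrite !mulmxnE mxE !eqxx -mulrnA => /eqP.
by rewrite [_ == _](eqr_nat int 1) mul2n => /eqP/(congr1 odd); rewrite odd_double.
Qed.

Theorem proposition3p9 (R : realType) (n : nat) (hn : (0 < n)%N) :
  exists A : {fset 'rV[int]_n}, supernormal R A /\ ~ unimodular R A.
Proof.
pose i0 := Ordinal hn.
pose E := [fset v in codom (delta_mx 0 : 'I_n -> 'rV[int]_n)]%fset.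
exists (delta_mx 0 i0 *+ 2 |` E)%fset; split.
  apply: axis_supernormal => [i | v].
    by rewrite !inE; apply/orP; right; apply: codom_f.
  rewrite !inE => /orP[/eqP-> | /codomP[i ->]]; first by exists i0, 2.
  by exists i, 1.
by apply: (not_unimodular_double _ _ _ i0); rewrite !inE eqxx.
Qed.
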